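(* Let $H=(V,E)$ be an oriented hypergraph, with integer coefficients. The following are equivalent: (i) $H_1$ and $H^1$ are canonically isomorphic; (ii) the annihilator $\{\psi\in C^1:\psi(x)=0\ \forall x\in\operatorname{Ker}\partial_1\}$ of $\operatorname{Ker}\partial_1$ in $C^1$ equals $\operatorname{Im}\delta^0$; (iii) $\mathcal B=\mathcal C^\perp$; (iv) $\operatorname{Im}\partial_1$ is a direct summand of $C_0$; (v) the map $[\psi]\mapsto\psi|_{\operatorname{Ker}\partial_1}$ is an isomorphism $H^1\to\mathrm{Hom}(H_1,\mathbb Z)$.
   Context: An oriented hypergraph $H=(V,E)$ consists of a finite set $V$ and a set $E$ of ordered pairs $(A,B)$ of disjoint subsets of $V$, where $E$ never contains both $(A,B)$ and $(B,A)$. $C_0,C_1$ are the free $\mathbb Z$-modules with bases $V,E$; $\partial_1\colon C_1\to C_0$ is the linear extension of $(A,B)\mapsto\sum_{v\in B}v-\sum_{v\in A}v$; $C^0=\mathrm{Hom}(C_0,\mathbb Z)$, $C^1=\mathrm{Hom}(C_1,\mathbb Z)$; $\delta^0(\varphi)=\varphi\circ\partial_1$. $H_1:=\operatorname{Ker}\partial_1$, $H^1:=C^1/\operatorname{Im}\delta^0$. $\gamma_1\colon C_1\to C^1$ with $\gamma_1(e)(e')=\delta_{ee'}$; $\langle\,,\rangle$ is the bilinear form on $C_1$ with $\langle e,e'\rangle=\delta_{ee'}$; $\mathcal C:=\operatorname{Ker}\partial_1$, $\mathcal B:=\gamma_1^{-1}(\operatorname{Im}\delta^0)$, $\mathcal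 C^\perp:=\{y\in C_1:\langle x,y\rangle=0\ \forall x\in\mathcal C\}$. Let $i\colon\operatorname{Ker}\partial_1\to C_1$ be the inclusion and $i^*\colon C^1\to(\operatorname{Ker}\partial_1)^*=\mathrm{Hom}(\operatorname{Ker}\partial_1,\mathbb Z)$, $\psi\mapsto\psi\circ i$. ''$H_1$ and $H^1$ are canonically isomorphic'' means that $\operatorname{Ker} i^*=\operatorname{Im}\delta^0$ and $i^*$ is surjective, so that one obtains the chain of isomorphisms $H_1=\operatorname{Ker}\partial_1\cong(\operatorname{Ker}\partial_1)^*=\operatorname{Im} i^*\cong C^1/\operatorname{Ker} i^*=C^1/\operatorname{Im}\delta^0=H^1$, using the map $C^1/\operatorname{Ker} i^*\to\operatorname{Im} i^*$, $[\psi]\mapsto\psi|_{\operatorname{Ker}\partial_1}$, and any isomorphism $\operatorname{Ker}\partial_1\cong(\operatorname{Ker}\partial_1)^*$. *)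

(* Defs.v *)
From HB Require Import structures.
From mathcomp Require Import all_boot all_order all_algebra.
From mathcomp Require Import boolp classical_sets.

Set Implicit Arguments.
Unset Strict Implicit.
Unset Printing Implicit Defensive.

Import GRing.Theory.

Local Open Scope ring_scope.
Local Open Scope quotient_scope.
Local Open Scope classical_set_scope.

(* Z-modules are rendered as abelian groups (zmodType), integers acting by *~, *)
(* and Z-linear maps as additive maps; Hom(U, V) is {additive U -> V} with     *)
(* the pointwise group structure declared here.                                *)
Section Hom.
Variables U V : zmodType.
Implicit Types f g h : {additive U -> V}.

HB.instance Definition _ := gen_eqMixin {additive U -> V}.
HB.instance Definition _ := gen_choiceMixin {additive U -> V}.

Definition hom_zero : {additive U -> V} := \0.
Definition hom_opp f : {additive U -> V} := \- f.
Definition hom_add f g : {additive U -> V} := f \+ g.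

Lemma homP f g : f =1 g -> f = g.
Proof.
case: f g => [f [[mf]]] [g [[mg]]] /= /funext efg.
case: _ / efg mg => mg; by rewrite (Prop_irrelevance mf mg).
Qed.

Fact hom_addA : associative hom_add.
Proof. by move=> f g h; apply: homP => x /=; rewrite addrA. Qed.
Fact hom_addC : commutative hom_add.
Proof. by move=> f g; apply: homP => x /=; rewrite addrC. Qed.
Fact hom_add0 : left_id hom_zero hom_add.
Proof. by move=> f; apply: homP => x /=; rewrite add0r. Qed.
Fact hom_addN : left_inverse hom_zero hom_opp hom_add.
Proof. by move=> f; apply: homP => x /=; rewrite addNr. Qed.

HB.instance Definition _ := GRing.isZmodule.Build {additive U -> V}
  hom_addA hom_addC hom_add0 hom_addN.

Lemma hom0E x : (0 : {additive U -> V}) x = 0. Proof. by []. Qed.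
Lemma homDE f g x : (f + g) x = f x + g x. Proof. by []. Qed.
Lemma homNE f x : (- f) x = - f x. Proof. by []. Qed.
Lemma homBE f g x : (f - g) x = f x - g x. Proof. by []. Qed.

End Hom.

Notation zdual M := {additive M -> int}.

Section Pullback.
Variables (U V : zmodType) (f : {additive U -> V}).

Definition pullback (phi : zdual V) : zdual U := phi \o f.

Fact pullback_is_zmod_morphism : zmod_morphism pullback.
Proof. by move=> phi psi; apply: homP. Qed.

HB.instance Definition _ :=
  GRing.isZmodMorphism.Build (zdual V) (zdual U) pullback
    pullback_is_zmod_morphism.

End Pullback.

Definition subgroup (M : zmodType) (N : set M) : Prop :=
  N 0 /\ forall x y, N x -> N y -> N (x - y).

Definition direct_summand (M : zmodType) (A : set M) : Prop :=
  exists N : set M,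
    [/\ subgroup A, subgroup N, A `&` N = [set 0]
      & forall x, exists a b, [/\ A a, N b & x = a + b]].

(* Free Z-module {ffun I -> int} on a finite type I. *)
Section FreeModule.
Variable I : finType.

Definition fbasis (i : I) : {ffun I -> int} := [ffun j => (i == j)%:R].

Definition coordf (i : I) (x : {ffun I -> int}) : int := x i.

Fact coordf_is_zmod_morphism i : zmod_morphism (coordf i).
Proof. by move=> x y; rewrite /coordf !ffunE. Qed.

HB.instance Definition _ i :=
  GRing.isZmodMorphism.Build {ffun I -> int} int (coordf i)
    (coordf_is_zmod_morphism i).

Lemma coordf_fbasis i j : coordf i (fbasis j) = (i == j)%:R.
Proof. by rewrite /coordf ffunE eq_sym. Qed.

Definition eform (x y : {ffun I -> int}) : int := \sum_i x i * y i.

Lemma eform_fbasis i j : eform (fbasis i) (fbasis j) = (i == j)%:R.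
Proof.
rewrite /eform (bigD1 i) //= big1 ?addr0 => [|k /negPf neq_ki].
  by rewrite !ffunE eqxx mul1r eq_sym.
by rewrite ffunE eq_sym neq_ki mul0r.
Qed.

Section LinearExtension.
Variables (M : zmodType) (f : I -> M).

Definition linext (x : {ffun I -> int}) : M := \sum_i f i *~ x i.

Fact linext_is_zmod_morphism : zmod_morphism linext.
Proof.
move=> x y; rewrite /linext -sumrB; apply: eq_bigr => i _.
by rewrite !ffunE mulrzBr.
Qed.

HB.instance Definition _ :=
  GRing.isZmodMorphism.Build {ffun I -> int} M linext linext_is_zmod_morphism.

Lemma linext_fbasis i : linext (fbasis i) = f i.
Proof.
rewrite /linext (bigD1 i) //= big1 ?addr0 => [|j /negPf neq_ji].
  by rewrite ffunE eqxx mulr1z.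
by rewrite ffunE eq_sym neq_ji mulr0z.
Qed.

End LinearExtension.
End FreeModule.

(* edges_oriented includes A = B, hence rules out the edge (set0, set0).       *)
Record oriented_hypergraph (V : finType) := OrientedHypergraph {
  edges :> {set {set V} * {set V}};
  edges_disjoint : forall A B : {set V}, (A, B) \in edges -> [disjoint A & B]%B;
  edges_oriented : forall A B : {set V},
    ~ ((A, B) \in edges /\ (B, A) \in edges)
}.

Section Homology.
Variables (V : finType) (H : oriented_hypergraph V).

Definition edge : finType := {e : {set V} * {set V} | e \in edges H}.

Definition C0 : zmodType := {ffun V -> int}.
Definition C1 : zmodType := {ffun edge -> int}.

Definition boundary (e : edge) : C0 :=
  \sum_(v in (val e).2) fbasis v - \sum_(v in (val e).1) fbasis v.

Definition bd1 : {additive C1 -> C0} := linext boundary.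

Definition delta0 : {additive zdual C0 -> zdual C1} := pullback bd1.

Definition ker_bd1 : {pred C1} := fun x => bd1 x == 0.

Fact ker_bd1_zmod_closed : zmod_closed ker_bd1.
Proof.
split=> [|x y]; rewrite !unfold_in ?raddf0 // raddfB => /eqP-> /eqP->.
by rewrite subr0.
Qed.

HB.instance Definition _ :=
  GRing.isZmodClosed.Build C1 ker_bd1 ker_bd1_zmod_closed.

Definition ker_type : Type := {x : C1 | x \in ker_bd1}.
HB.instance Definition _ := SubChoice.on ker_type.
HB.instance Definition _ := [SubChoice_isSubZmodule of ker_type by <:].

Definition H_1 : zmodType := ker_type.

Definition ker_incl : {additive H_1 -> C1} := (val : ker_type -> C1).

Definition ker_incl_star : {additive zdual C1 -> zdual H_1} := pullback ker_incl.

(* Boolean form of range delta0, as required by Quotient.quot. *)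
Definition im_delta0 : {pred zdual C1} := fun psi => `[< range delta0 psi >].

Fact im_delta0_zmod_closed : zmod_closed im_delta0.
Proof.
split=> [|_ _ /asboolP[phi _ <-] /asboolP[psi _ <-]]; apply/asboolP.
  by exists 0; rewrite ?raddf0.
by exists (phi - psi); rewrite ?raddfB.
Qed.

HB.instance Definition _ :=
  GRing.isZmodClosed.Build (zdual C1) im_delta0 im_delta0_zmod_closed.

Definition H__1 : zmodType := Quotient.quot im_delta0.

Definition cls (psi : zdual C1) : H__1 := \pi_(Quotient.quot im_delta0) psi.

Fact clsB psi psi' : cls (psi - psi') = cls psi - cls psi'.
Proof. by rewrite /cls raddfB. Qed.

Lemma cls_eq psi psi' : cls psi = cls psi' <-> range delta0 (psi - psi').
Proof.
split=> [/eqP | psiB].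
  by rewrite /cls -Quotient.idealrBE => /asboolP.
by apply/eqP; rewrite /cls -Quotient.idealrBE; apply/asboolP.
Qed.

(* Defined on representatives; well defined by [restr_cls]. *)
Definition restr_fun (c : H__1) : zdual H_1 :=
  ker_incl_star (repr (c : Quotient.quot im_delta0)).

Lemma restr_cls psi : restr_fun (cls psi) = ker_incl_star psi.
Proof.
apply/eqP; rewrite -subr_eq0 -raddfB; apply/eqP.
have /cls_eq[phi _ <-] :
    cls (repr (cls psi : Quotient.quot im_delta0)) = cls psi.
  by rewrite /cls reprK.
apply: homP => -[x xK] /=; move: xK; rewrite unfold_in => /eqP.
by rewrite /ker_incl /= => ->; rewrite raddf0.
Qed.

Fact restr_is_zmod_morphism : zmod_morphism restr_fun.
Proof.
move=> a b.
have clsK (c : H__1) : cls (repr (c : Quotient.quot im_delta0)) = c.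
  exact: (@reprK _ (Quotient.quot im_delta0)).
by rewrite -[in LHS](clsK a) -[in LHS](clsK b) -clsB restr_cls raddfB.
Qed.

HB.instance Definition _ :=
  GRing.isZmodMorphism.Build H__1 (zdual H_1) restr_fun restr_is_zmod_morphism.

Definition restr : {additive H__1 -> zdual H_1} := restr_fun.

(* gamma1 e is the coordinate functional of e, so gamma1 e e' = delta_ee'. *)
Definition gamma1 : {additive C1 -> zdual C1} :=
  linext (fun e : edge => coordf e : zdual C1).

Lemma gamma1_fbasis (e e' : edge) :
  gamma1 (fbasis e) (fbasis e') = (e == e')%:R.
Proof. by rewrite /gamma1 /= linext_fbasis /= coordf_fbasis. Qed.

Definition cycles : set C1 := [set x | bd1 x = 0].
Definition cuts : set C1 := gamma1 @^-1` range delta0.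
Definition perp (X : set C1) : set C1 :=
  [set y | forall x, X x -> eform x y = 0].

Definition annihilator (X : set C1) : set (zdual C1) :=
  [set psi | forall x, X x -> psi x = 0].

(* The isomorphism H_1 -> H__1 factors through zdual H_1; its first link,      *)
(* between ker bd1 and its dual, always exists as ker bd1 is free of finite    *)
(* rank, so only the two conditions on the restriction map remain.             *)
Definition canonically_isomorphic : Prop :=
  [set psi | ker_incl_star psi = 0] = range delta0
  /\ range ker_incl_star = [set: zdual H_1].

End Homology.

(* set T unfolds to an arrow, so H would otherwise be implicit. *)
Arguments cycles {V} H _.
Arguments cuts {V} H _.

(* Main.v *)
(* Smith normal form makes Ker bd1 the image of an idempotent p of C1, so that *)
(* every functional on Ker bd1 extends to C1, whatever the hypergraph.  What   *)
(* varies is whether a functional vanishing on Ker bd1 factors through bd1.    *)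
(* If they all do, the coordinates of 1 - p do, so 1 - p = g o bd1 for some g; *)
(* then bd1 o g o bd1 = bd1 and Ker (bd1 o g) is a complement of Im bd1.       *)
(* Conversely, a functional vanishing on Ker bd1 descends to Im bd1 and        *)
(* extends by 0 on a complement.                                               *)
From HB Require Import structures.
Require Import Defs.
From mathcomp Require Import all_boot all_order all_algebra.
From mathcomp Require Import boolp classical_sets.
Import GRing.Theory.
Local Open Scope ring_scope.
Local Open Scope classical_set_scope.

(** The conditions are linked in a cycle. By [gamma1E] and [gamma1_surj], [gamma1] identifies chains
    with functionals and turns evaluation into [eform], so the condition on cuts is the annihilator
    condition read inside [C1]. The idempotent of [ker_proj] yields both the extension of
    functionals ([ker_incl_star_surj]) and, with [direct_summand_pinv], the splitting of the image;
    [direct_summand_factor] leads back from the splitting to functionals. *)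

Lemma int_kermx_proj m n (M : 'M[int]_(m, n)) :
  exists P : 'M[int]_m,
    P *m M = 0 /\ forall x : 'rV_m, x *m M = 0 -> x *m P = x.
Proof.
have [L Lu [R Ru [d _ ->]]] := int_Smith_normal_form M.
set D := \matrix_(i, j) _.
(* [Q] keeps the coordinates whose row in [D] is zero; these span the left kernel of [D]. *)
pose Q : 'M[int]_m := diag_mx (\row_i (row i D == 0)%:R).
have QD : Q *m D = 0.
  apply/row_matrixP => i; rewrite row_mul row_diag_mx -scalemxAl -rowE row0 mxE.
  by case: eqP => [-> | _]; rewrite ?scaler0 ?scale0r.
have DQ (y : 'rV_m) : y *m D = 0 -> y *m Q = y.
  move=> yD; apply/rowP => i; rewrite mul_mx_diag !mxE.
  case: eqP => [_ | /eqP/rV0Pn[j]]; first by rewrite mulr1.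
  rewrite !mxE; have [eij | _] := eqVneq (i : nat) j; last by rewrite mulr0n eqxx.
  rewrite mulr1n => di; rewrite mulr0; apply/esym/eqP.
  (* Column [j] of [D] is nonzero only in row [i], so this coordinate of [y *m D] is a nonzero
     multiple of [y 0 i]. *)
  move/rowP/(_ j): yD; rewrite !mxE (bigD1 i) //= big1 => [|k neq_ki].
    by rewrite mxE eij eqxx addr0 mulr1n -eij => /eqP; rewrite mulf_eq0 (negPf di) orbF.
  by rewrite mxE -eij (inj_eq val_inj) (negPf neq_ki) mulr0.
(* As [R] is invertible, [x] is in the left kernel of [M] iff [x *m L] is in that of [D]; hence the
   conjugate of [Q] by [L]. *)
exists (L *m Q *m invmx L); split=> [|x].
  by rewrite !mulmxA mulmxKV // -(mulmxA L) QD mulmx0 mul0mx.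
rewrite !mulmxA => xM; have /DQ-> : x *m L *m D = 0; last exact: mulmxK.
by rewrite -(mulmxK Ru (_ *m D)) xM mul0mx.
Qed.

Lemma ffun_fbasisE (I : finType) (x : {ffun I -> int}) :
  x = \sum_i fbasis i *~ x i.
Proof.
apply/ffunP => j; rewrite -[RHS]/(coordf j _) raddf_sum (bigD1 j) //= big1.
  by rewrite raddfMz /= coordf_fbasis eqxx addr0 intz.
by move=> i /negPf neq_ij; rewrite raddfMz /= coordf_fbasis eq_sym neq_ij mul0rz.
Qed.

Lemma additive_fbasisE (I : finType) (M : zmodType)
    (f : {additive {ffun I -> int} -> M}) x :
  f x = \sum_i f (fbasis i) *~ x i.
Proof.
rewrite {1}(ffun_fbasisE _ x) raddf_sum.
by apply: eq_bigr => i _; rewrite raddfMz.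
Qed.

Lemma ker_proj (I J : finType)
    (f : {additive {ffun I -> int} -> {ffun J -> int}}) :
  exists p : {additive {ffun I -> int} -> {ffun I -> int}},
    (forall x, f (p x) = 0) /\ (forall x, f x = 0 -> p x = x).
Proof.
pose rowf (K : finType) (x : {ffun K -> int}) : 'rV[int]_#|K| :=
    \row_i x (enum_val i).
pose M : 'M[int]_(#|I|, #|J|) := \matrix_i rowf J (f (fbasis (enum_val i))).
have rowf_mul (K : finType) (g : {additive {ffun I -> int} -> {ffun K -> int}}) x :
    rowf K (g x) = rowf I x *m \matrix_i rowf K (g (fbasis (enum_val i))).
  apply/rowP => j; rewrite !mxE additive_fbasisE -[LHS]/(coordf _ _) raddf_sum.
  rewrite (reindex _ (onW_bij _ (enum_val_bij I))) /=; apply: eq_bigr => i _.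
  by rewrite raddfMz !mxE mulrC mulrzz.
have rowf_inj (K : finType) : injective (rowf K).
  move=> x y /rowP exy; apply/ffunP => k.
  by have := exy (enum_rank k); rewrite !mxE enum_rankK.
have rowf0 K : rowf K 0 = 0 by apply/rowP => k; rewrite !mxE ffunE.
have [P [PM MP]] := int_kermx_proj _ _ M.
pose p : {additive _ -> _} :=
  linext (fun i : I => [ffun k => P (enum_rank i) (enum_rank k)]).
have rowp x : rowf I (p x) = rowf I x *m P.
  rewrite rowf_mul; congr (_ *m _); apply/matrixP => i k.
  by rewrite !mxE /p /= linext_fbasis ffunE !enum_valK.
exists p; split=> x.
  by apply: rowf_inj; rewrite rowf_mul rowp -mulmxA PM mulmx0 rowf0.
by move=> fx; apply: rowf_inj; rewrite rowp MP // -rowf_mul fx rowf0.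
Qed.

(** The composite [f \o g] is an idempotent with image [range f], and its kernel is the
    complement. *)
Lemma direct_summand_pinv (U W : zmodType) (f : {additive U -> W})
    (g : {additive W -> U}) :
  (forall x, f (g (f x)) = f x) -> direct_summand (range f).
Proof.
move=> fgf; exists [set y | f (g y) = 0]; split.
- by split=> [|_ _ [x _ <-] [y _ <-]]; [exists 0; rewrite ?raddf0
                                        | exists (x - y); rewrite ?raddfB].
- by split=> [|x y] /=; rewrite ?raddf0 // !raddfB => -> ->; rewrite subr0.
- apply/seteqP; split=> [_ [[x _ <-] /=] | _ ->]; first by rewrite fgf.
  by split=> /=; [exists 0; rewrite ?raddf0 | rewrite !raddf0].
move=> y; exists (f (g y)), (y - f (g y)); split.
- by exists (g y).
- by rewrite /= !raddfB fgf subrr.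
- by rewrite addrC subrK.
Qed.

Lemma direct_summand_factor (U W Z : zmodType) (f : {additive U -> W})
    (psi : {additive U -> Z}) :
  direct_summand (range f) -> (forall x, f x = 0 -> psi x = 0) ->
  exists phi : {additive W -> Z}, forall x, phi (f x) = psi x.
Proof.
case=> N [_ [N0 NB] capN decN] psi0.
(* [s y] is a chosen preimage of the component of [y] in [range f]. The choice need not be additive,
   but [psi] does not see it, since two choices differ by an element of the kernel of [f]. *)
have /choice[s sN] y : exists x, N (y - f x).
  by have [_ [b [[x _ <-] Nb ->]]] := decN y; exists x; rewrite addrC addKr.
have psiE x y : N (f x - f y) -> psi x = psi y.
  move=> Nxy; apply/eqP; rewrite -subr_eq0 -raddfB; apply/eqP/psi0.
  have : (range f `&` N) (f (x - y)) by rewrite raddfB; split=> //; exists (x - y); rewrite ?raddfB.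
  by rewrite capN.
have phiB : zmod_morphism (psi \o s).
  move=> y z /=; rewrite -raddfB; apply: psiE.
  have := NB _ _ (NB _ _ (sN y) (sN z)) (sN (y - z)).
  have -> : y - f (s y) - (z - f (s z)) = y - z - f (s y - s z).
    by rewrite raddfB !opprD addrACA.
  by rewrite opprB addrC subrKA.
pose phiM := GRing.isZmodMorphism.Build W Z (psi \o s) phiB.
pose phi : {additive W -> Z} := HB.pack (psi \o s) phiM.
by exists phi => x; apply/esym/psiE.
Qed.

Section Hypergraph.
Variables (V : finType) (H : oriented_hypergraph V).

Lemma gamma1E (x y : C1 H) : gamma1 H y x = eform x y.
Proof.
(* Evaluation at [x] is additive in the functional, so it passes through the sum defining
   [linext]. *)
pose ev : zdual (C1 H) -> int := fun psi => psi x.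
have evB : zmod_morphism ev by [].
pose evM := GRing.isZmodMorphism.Build _ _ ev evB.
pose eva : {additive zdual (C1 H) -> int} := HB.pack ev evM.
rewrite -[LHS]/(eva (linext _ y)) raddf_sum; apply: eq_bigr => e _.
by rewrite raddfMz -mulrzz.
Qed.

Lemma gamma1_surj (psi : zdual (C1 H)) : exists y, gamma1 H y = psi.
Proof.
exists [ffun e => psi (fbasis e)]; apply: homP => x.
rewrite gamma1E additive_fbasisE; apply: eq_bigr => e _.
by rewrite ffunE mulrC mulrzz.
Qed.

Lemma ker_incl_starP (psi : zdual (C1 H)) :
  ker_incl_star H psi = 0 <-> annihilator (cycles H) psi.
Proof.
split=> [psi0 x /eqP xK | psi0]; last first.
  by apply: homP => -[x xK]; apply: psi0; apply/eqP.
by rewrite -[LHS]/(ker_incl_star H psi (Sub x xK : ker_type H)) psi0.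
Qed.

Lemma range_delta0_sub_annihilator :
  range (delta0 H) `<=` annihilator (cycles H).
Proof. by move=> _ [phi _ <-] x /= ->; rewrite raddf0. Qed.

Lemma ker_incl_star_surj (f : zdual (H_1 H)) :
  exists psi, ker_incl_star H psi = f.
Proof.
have [p [pK Kp]] := ker_proj _ _ (bd1 H).
have pker x : p x \in ker_bd1 (H := H) by rewrite unfold_in pK.
(* [q] is [p] with values in the kernel; [f \o q] extends [f] because [p] fixes cycles. *)
pose q x : ker_type H := Sub (p x) (pker x).
have qB : zmod_morphism (f \o q).
  move=> x y /=; rewrite -raddfB; congr (f _); apply: val_inj.
  by rewrite raddfB /= raddfB.
pose psiM := GRing.isZmodMorphism.Build (C1 H) int (f \o q) qB.
pose psi : zdual (C1 H) := HB.pack (f \o q) psiM.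
exists psi; apply: homP => -[x xK] /=; congr (f _).
by apply: val_inj => /=; apply: Kp; apply/eqP.
Qed.

Lemma canonically_isomorphic_annihilator :
  canonically_isomorphic H -> annihilator (cycles H) = range (delta0 H).
Proof.
by case=> <- _; apply/seteqP; split=> psi; apply ker_incl_starP.
Qed.

Lemma annihilator_cuts :
  annihilator (cycles H) = range (delta0 H) -> cuts H = perp (cycles H).
Proof.
rewrite /cuts => <-.
by apply/seteqP; split=> y yP x /yP; rewrite gamma1E.
Qed.

Lemma cuts_direct_summand :
  cuts H = perp (cycles H) -> direct_summand (range (bd1 H)).
Proof.
move=> cutsE; have [p [pK Kp]] := ker_proj _ _ (bd1 H).
(* The coordinates of [1 - p] vanish on cycles, so each is a coboundary [delta0 H (phi e)]. *)
pose c e : zdual (C1 H) := coordf e \o (idfun \- p).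
have /choice[phi phiE] e : exists phi, delta0 H phi = c e.
  have [y yE] := gamma1_surj (c e).
  have [phi _ phiE] : cuts H y; last by exists phi; rewrite -yE.
  rewrite cutsE => x xK; rewrite -gamma1E yE /= Kp // subrr; exact: raddf0.
(* With the [phi e] as coordinates, [g] satisfies [g \o bd1 = 1 - p]. *)
pose g y : C1 H := [ffun e => phi e y].
have gB : zmod_morphism g by move=> x y; apply/ffunP => e; rewrite !ffunE raddfB.
pose gM := GRing.isZmodMorphism.Build (C0 V) (C1 H) g gB.
pose ga : {additive C0 V -> C1 H} := HB.pack g gM.
apply: (direct_summand_pinv _ _ _ ga) => x.
suff -> : ga (bd1 H x) = x - p x by rewrite raddfB pK subr0.
by apply/ffunP => e; rewrite ffunE -[LHS]/(delta0 H (phi e) x) phiE.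
Qed.

(** Injectivity is [direct_summand_factor] applied to a difference of representatives; surjectivity
    is [ker_incl_star_surj]. *)
Lemma direct_summand_bijective_restr :
  direct_summand (range (bd1 H)) -> bijective (restr H).
Proof.
move=> dsH.
have clsK (c : H__1 H) : exists psi, cls psi = c.
  by exists (repr (c : Quotient.quot (im_delta0 (H := H)))); apply: reprK.
have restr_inj : injective (restr H).
  move=> a b; have [[psi <-] [psi' <-]] := (clsK a, clsK b).
  rewrite /restr /= !restr_cls => /eqP; rewrite -subr_eq0 -raddfB => /eqP.
  move=> /ker_incl_starP/(direct_summand_factor _ _ _ _ _ dsH)[phi phiE].
  by apply/cls_eq; exists phi => //; apply: homP.
have /choice[s sE] (f : zdual (H_1 H)) : exists c, restr H c = f.
  by have [psi <-] := ker_incl_star_surj f; exists (cls psi); apply: restr_cls.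
by exists s => // c; apply: restr_inj; rewrite sE.
Qed.

Lemma bijective_restr_canonically_isomorphic :
  bijective (restr H) -> canonically_isomorphic H.
Proof.
move=> /bij_inj restr_inj; split.
  apply/seteqP; split=> psi; last first.
    by move/range_delta0_sub_annihilator => psi0; apply/ker_incl_starP.
  (* Writing [psi] as [psi - 0] turns being a coboundary into having the same class as [0]. *)
  move=> psi0; rewrite -[psi]subr0; apply/cls_eq/restr_inj.
  by rewrite /restr /= !restr_cls raddf0; exact: psi0.
apply/seteqP; split=> // f _; have [psi <-] := ker_incl_star_surj f.
by exists psi.
Qed.

End Hypergraph.

Theorem theorem14 (V : finType) (H : oriented_hypergraph V) :
  [<-> canonically_isomorphic H;
       annihilator (cycles H) = range (delta0 H);
       cuts H = perp (cycles H);
       direct_summand (range (bd1 H));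
       bijective (restr H)].
Proof.
tfae.
- exact: canonically_isomorphic_annihilator.
- exact: annihilator_cuts.
- exact: cuts_direct_summand.
- exact: direct_summand_bijective_restr.
- exact: bijective_restr_canonically_isomorphic.
Qed.
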